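(* Let $k\ge1$ and let $B_k$ be the unwrapped butterfly graph with $(k+1)2^k$ vertices. Counted with multiplicity, the eigenvalues of the Laplacian $L(B_k)=D-A$ of $B_k$ are exactly the following: <ul> <li>for $j=0,\dots,k$, the value $4-4\cos\!\left(\frac{\pi j}{k+1}\right)$, each with multiplicity $1$;</li> <li>for each $i=1,\dots,k$ and $j=0,\dots,i-1$, the value $4-4\cos\!\left(\frac{\pi(2j+1)}{2i+1}\right)$, with multiplicity $2^{k-i+1}$;</li> <li>for each $i=1,\dots,k-1$ and $j=1,\dots,i$, the value $4-4\cos\!\left(\frac{j\pi}{i+1}\right)$, with multiplicity $(k-i)2^{k-i-1}$.</li> </ul> Multiplicities of equal values arising from different items or indices are added.
   Context: The unwrapped butterfly graph $B_k$ is the undirected unweighted graph defined recursively. $B_0$ is a single vertex. $B_k$ consists of two disjoint copies of $B_{k-1}$, each with a last column of $2^{k-1}$ vertices $V_{k,j}$ and $V'_{k,j}$ ($j=1,\dots,2^{k-1}$), together with a new column of $2^k$ vertices $V_{k+1,j},V'_{k+1,j}$ ($j=1,\dots,2^{k-1}$). The new column is joined by the edges $\{V_{k,j},V_{k+1,j}\}$, $\{V'_{k,j},V'_{k+1,j}\}$, $\{V_{k,j},V'_{k+1,j}\}$ and $\{V'_{k,j},V_{k+1,j}\}$. Equivalently, $B_k$ has vertex set $\{(c,w): 0\le c\le k,\ w\in\{0,1\}^k\}$, and for each $1\le c\le k$ the vertex $(c-1,w)$ is adjacent to $(c,w)$ and to $(c,w\oplus e_c)$. $D$ is the degree matrix and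 $A$ the adjacency matrix of $B_k$. *)

(* Defs.v *)
From HB Require Import structures.
From mathcomp Require Import all_boot all_order all_algebra.
From mathcomp Require Import reals trigo.
Set Implicit Arguments. Unset Strict Implicit. Unset Printing Implicit Defensive.
Import Order.TTheory GRing.Theory Num.Theory.
Local Open Scope ring_scope.

(* Vertices of the unwrapped butterfly B_k: pairs (c, w), 0 <= c <= k,
   w in {0,1}^k (bits indexed 0..k-1; e_c of the paper is bit c-1). *)
Definition bvert (k : nat) := ('I_k.+1 * {ffun 'I_k -> bool})%type.

Definition flipbit (k : nat) (w : {ffun 'I_k -> bool}) (i : 'I_k) : {ffun 'I_k -> bool} :=
  [ffun j => if j == i then ~~ w j else w j].

(* directed "forward" edge (c-1, w) -> (c, w) or (c, w xor e_c), 1 <= c <= k;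
   here c1 = c-1 and the flipped bit has 0-based index c1 *)
Definition bfwd (k : nat) (u v : bvert k) : bool :=
  (val v.1 == (val u.1).+1) &&
  [exists i : 'I_k, (val i == val u.1) && ((v.2 == u.2) || (v.2 == flipbit u.2 i))].

Definition badj (k : nat) (u v : bvert k) : bool := bfwd u v || bfwd v u.

Definition bdeg (k : nat) (u : bvert k) : nat := #|[set v | badj u v]|.

Definition blaplacian (R : realType) (k : nat) : 'M[R]_#|{: bvert k}| :=
  \matrix_(i, j)
    (let u := enum_val i in let v := enum_val j in
     (if u == v then (bdeg u)%:R else 0) - (badj u v)%:R).

Definition bspec (R : realType) (k : nat) : seq R :=
  [seq 4 - 4 * cos (pi * j%:R / (k.+1)%:R) | j <- iota 0 k.+1]
  ++ flatten [seq flatten [seq nseq (2 ^ (k - i + 1))%N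
                    (4 - 4 * cos (pi * (2 * j + 1)%N%:R / (2 * i + 1)%N%:R))
                  | j <- iota 0 i] | i <- iota 1 k]
  ++ flatten [seq flatten [seq nseq ((k - i) * 2 ^ (k - i - 1))%N
                    (4 - 4 * cos (j%:R * pi / (i.+1)%:R))
                  | j <- iota 1 i] | i <- iota 1 (k - 1)%N].

(* Main.v *)
Require Import Defs.
From mathcomp Require Import all_boot all_order all_algebra.
From mathcomp Require Import reals trigo.
From mathcomp Require Import perm ring zify.
Import Order.TTheory GRing.Theory Num.Theory.
Set Implicit Arguments. Unset Strict Implicit. Unset Printing Implicit Defensive.
Local Open Scope ring_scope.

(** The Walsh transform in the word coordinate turns the edges between columns
    [c] and [c+1] into multiplication by [1 + (-1)^(s_c)], i.e. by [2] or [0].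
    Hence the Laplacian is similar to a direct sum, over [s] in [{0,1}^k], of
    tridiagonal matrices with diagonal [2,4,...,4,2], each of which splits into
    paths at the ones of [s].  With [y = X - 4], [c = 2] and [U] the Lucas sequence
    of parameters [y] and [c^2], a path on [n] vertices has characteristic polynomial
    [U_(n+1)], [U_(n+1) + c U_n] or [(y + 2c) U_n] according to whether none, one
    or both of its ends have degree [2]; as [U_n] at [y = 2c cos t] is
    [c^(n-1) sin(nt) / sin t], the roots are the cosines of the statement.  Reading
    [s] bit by bit, each completed path contributes a factor, and the product over
    all [s] satisfies a recursion that yields the multiplicities. *)

Section BigOps.
Variables (V : Type) (idx : V) (op : Monoid.com_law idx).

Lemma big_ffun_tuple (T : finType) n (F : n.-tuple T -> V) :
  \big[op/idx]_(f : {ffun 'I_n -> T}) F [tuple f i | i < n] =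
  \big[op/idx]_(t : n.-tuple T) F t.
Proof.
rewrite [RHS](reindex (fun f : {ffun 'I_n -> T} => [tuple f i | i < n])) //.
exists (fun t : n.-tuple T => [ffun i => tnth t i]) => t _.
  by apply/ffunP => i; rewrite ffunE tnth_mktuple.
by apply: eq_from_tnth => i; rewrite tnth_mktuple ffunE.
Qed.

Lemma big_tuple0 (T : finType) (F : seq T -> V) :
  \big[op/idx]_(t : 0.-tuple T) F t = F [::].
Proof. by rewrite (big_pred1 [tuple]) // => t; apply/esym/eqP; rewrite [t]tuple0. Qed.

Lemma big_tuple_rcons (T : finType) n (F : seq T -> V) :
  \big[op/idx]_(t : n.+1.-tuple T) F t =
  \big[op/idx]_(x : T) \big[op/idx]_(t : n.-tuple T) F (rcons t x).
Proof.
rewrite exchange_big pair_bigA.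
pose rcons_pair (u : n.-tuple T * T) := [tuple of rcons u.1 u.2].
have rcons_pair_inj : injective rcons_pair.
  move=> [t x] [t' x'] /(congr1 val) /= /rcons_inj[tt' ->].
  by congr (_, _); apply: val_inj.
have rcons_pair_bij : bijective rcons_pair.
  by apply: inj_card_bij rcons_pair_inj _; rewrite card_prod !card_tuple expnSr.
by rewrite (reindex rcons_pair) //; apply: onW_bij.
Qed.

Lemma big_pair_fst (S T : finType) (a : S) (F : S * T -> V) :
  \big[op/idx]_(u | u.1 == a) F u = \big[op/idx]_y F (a, y).
Proof.
rewrite (reindex_onto (pair a) snd) => [|[x y] /eqP /= <- //].
by apply: eq_bigl => y; rewrite !eqxx.
Qed.

End BigOps.

Lemma sumr_mulrb (V : nmodType) (I : finType) (P : pred I) (F : I -> V) :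
  \sum_i F i *+ P i = \sum_(i | P i) F i.
Proof. by rewrite [RHS]big_mkcond; apply: eq_bigr => i _; rewrite mulrb. Qed.

Lemma sum_ord_delta (V : nmodType) n m (F : nat -> V) :
  \sum_(i < n) F i *+ (i == m :> nat) = F m *+ (m < n)%N.
Proof.
rewrite sumr_mulrb; case: ltnP => [lt_mn | le_nm].
  by rewrite (big_pred1 (Ordinal lt_mn)).
by rewrite big_pred0 // => i; rewrite ltn_eqF // (leq_trans (ltn_ord i)).
Qed.

Lemma prodr_flatten_nseq (A : comPzSemiRingType) (I J T : Type) (F : T -> A)
    (f : I -> J -> T) (e : I -> nat) (r : I -> seq J) (s : seq I) :
  \prod_(z <- flatten [seq flatten [seq nseq (e i) (f i j) | j <- r i] | i <- s]) F z
  = \prod_(i <- s) (\prod_(j <- r i) F (f i j)) ^+ e i.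
Proof.
rewrite big_flatten big_map; apply: eq_bigr => i _.
rewrite big_flatten big_map -prodrXl; apply: eq_bigr => j _.
by rewrite big_nseq iter_mulr_1.
Qed.

(** * Matrices indexed by a finite type *)

Lemma det_castmx (A : comPzRingType) m n (eq_mn : m = n) (M : 'M[A]_m) :
  \det (castmx (eq_mn, eq_mn) M) = \det M.
Proof. by case: n / eq_mn; rewrite castmx_id. Qed.

Lemma det_mxdiag (A : comPzRingType) n (p_ : 'I_n -> nat)
    (B : forall i, 'M[A]_(p_ i)) :
  \det (\mxdiag_i B i) = \prod_i \det (B i).
Proof.
elim: n p_ B => [|n IH] p_ B.
  rewrite [RHS]big_ord0; move: (\mxdiag_i B i) (big_ord0 0%N addn xpredT p_).
  by move: (\sum_i p_ i)%N => m M m0; subst m; apply: det_mx00.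
by rewrite mxdiag_recl det_castmx det_lblock IH big_ord_recl.
Qed.

Lemma det_mxsub_bij (A : comPzRingType) m n (g : 'I_n -> 'I_m) (M : 'M[A]_m) :
  bijective g -> \det (mxsub g g M) = \det M.
Proof.
move=> g_bij; have eq_nm : n = m by have := bij_eq_card g_bij; rewrite !card_ord.
case: m / eq_nm g M g_bij => g M /bij_inj g_inj.
have -> : mxsub g g M = row_perm (perm g_inj) (col_perm (perm g_inj) M).
  by apply/matrixP => i j; rewrite !mxE !permE.
rewrite row_permE col_permE !det_mulmx !det_perm odd_permV.
by rewrite mulrCA mulrA -mulrA -expr2 sqrr_sign mulr1.
Qed.

Lemma char_poly_intertwine (A : idomainType) n (P M N : 'M[A]_n) :
  \det P != 0 -> M *m P = P *m N -> char_poly M = char_poly N.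
Proof.
move=> det_P MP; have det_P' : \det (map_mx polyC P) != 0.
  by rewrite det_map_mx polyC_eq0.
apply: (mulIf det_P'); rewrite [RHS]mulrC -!det_mulmx; congr (\det _).
by rewrite /char_poly_mx mulmxBl mulmxBr -!map_mxM MP scalar_mxC.
Qed.

Section FinMatrix.
Variables (A : comPzRingType) (T : finType).
Implicit Types f g : T -> T -> A.

Definition fin_mx f : 'M[A]_#|T| := \matrix_(i, j) f (enum_val i) (enum_val j).

Lemma eq_fin_mx f g : f =2 g -> fin_mx f = fin_mx g.
Proof. by move=> fg; apply/matrixP => i j; rewrite !mxE. Qed.

Lemma fin_mx_scalar a : fin_mx (fun u v => a *+ (u == v)) = a%:M.
Proof. by apply/matrixP => i j; rewrite !mxE (inj_eq enum_val_inj). Qed.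

Lemma mul_fin_mx f g :
  fin_mx f *m fin_mx g = fin_mx (fun u v => \sum_w f u w * g w v).
Proof.
apply/matrixP => i j; rewrite !mxE [RHS](big_enum_val (A := predT)).
by apply: eq_bigr => k _; rewrite !mxE.
Qed.

Lemma det_fin_mx_reindex f n (h : 'I_n -> T) :
  bijective h -> \det (fin_mx f) = \det (\matrix_(i, j) f (h i) (h j)).
Proof.
move=> h_bij; have rank_bij : bijective (enum_rank \o h).
  by apply: bij_comp => //; apply: enum_rank_bij.
rewrite -(det_mxsub_bij _ rank_bij); congr (\det _).
by apply/matrixP => i j; rewrite !mxE /= !enum_rankK.
Qed.

End FinMatrix.

Section FinBlockDiagonal.
Variables (A : comPzRingType) (S : finType) (n : nat) (B : S -> 'M[A]_n).

Definition fin_block_mx : 'M[A]_#|{: 'I_n * S}| :=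
  fin_mx (fun u v => B u.2 u.1 v.1 *+ (u.2 == v.2)).

Lemma det_fin_block_mx : \det fin_block_mx = \prod_s \det (B s).
Proof.
pose p_ := fun _ : 'I_#|S| => n.
pose h (i : 'I_(\sum_i p_ i)) : 'I_n * S :=
  (tagnat.sig2 i, enum_val (tagnat.sig1 i)).
have h_bij : bijective h.
  exists (fun u => @tagnat.Rank _ p_ (enum_rank u.2) u.1) => [i|[c s]].
    by rewrite /h /= enum_valK tagnat.sig2K.
  rewrite /h /= tagnat.Rank1K enum_rankK; congr (_, _).
  by apply: val_inj; rewrite /= tagnat.Rank2K.
rewrite (det_fin_mx_reindex _ h_bij) [RHS](big_enum_val (A := predT)).
rewrite -(det_mxdiag (p_ := p_)); congr (\det _); apply/matrixP => i j.
rewrite !mxE /= (inj_eq enum_val_inj).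
by case: eqP => // _; rewrite ?conform_mx_id ?mxE.
Qed.

End FinBlockDiagonal.

Lemma char_poly_fin_block_mx (A : comNzRingType) (S : finType) n (B : S -> 'M[A]_n) :
  char_poly (fin_block_mx B) = \prod_s char_poly (B s).
Proof.
rewrite -det_fin_block_mx; congr (\det _); apply/matrixP => i j.
rewrite !mxE -(inj_eq enum_val_inj).
case: (enum_val i) (enum_val j) => c s [c' s'] /=; rewrite xpair_eqE.
by case: (s == s'); rewrite ?andbT ?andbF ?subr0.
Qed.

(** * Tridiagonal matrices *)

Section Tridiagonal.
Variable A : comNzRingType.
Implicit Types d b : nat -> A.

Definition tridiag_mx n d b : 'M[A]_n :=
  \matrix_(i, j) (d i *+ (i == j :> nat) + b i *+ (j == i.+1 :> nat)
                  + b j *+ (i == j.+1 :> nat)).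

Lemma eq_tridiag_mx n d d' b b' :
  {in gtn n, d =1 d'} -> b =1 b' -> tridiag_mx n d b = tridiag_mx n d' b'.
Proof.
by move=> dd' bb'; apply/matrixP => i j; rewrite !mxE dd' ?bb' // inE ltn_ord.
Qed.

Lemma row_sum_tridiag n d b (i : 'I_n.+1) :
  \sum_j tridiag_mx n.+1 d b i j = d i + b i *+ (i < n)%N + b i.-1 *+ (0 < i)%N.
Proof.
under eq_bigr do rewrite mxE; rewrite !big_split /=; congr (_ + _ + _).
- under eq_bigr do rewrite eq_sym; rewrite (sum_ord_delta _ _ (fun=> d i)).
  by rewrite ltn_ord.
- by rewrite (sum_ord_delta _ _ (fun=> b i)) ltnS.
case: i => [[|i] lt_in] /=; first by rewrite big1.
under eq_bigr do rewrite eqSS eq_sym; rewrite sum_ord_delta.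
by rewrite (ltn_trans _ lt_in).
Qed.

Lemma det_tridiag1 d b : \det (tridiag_mx 1 d b) = d 0%N.
Proof. by rewrite det_mx11 mxE !addr0. Qed.

Lemma det_tridiagSS n d b :
  \det (tridiag_mx n.+2 d b) =
  d 0%N * \det (tridiag_mx n.+1 (d \o S) (b \o S)) -
  b 0%N ^+ 2 * \det (tridiag_mx n (d \o S \o S) (b \o S \o S)).
Proof.
rewrite (expand_det_row _ ord0) big_ord_recl mxE !addr0; congr (_ * _ + _).
  rewrite /cofactor addn0 expr0 mul1r; congr (\det _).
  by apply/matrixP => i j; rewrite !mxE /= /bump !add1n !eqSS.
rewrite big_ord_recl big1 ?addr0 => [|i _]; last first.
  by rewrite mxE !addr0 mul0r.
rewrite mxE /cofactor (expand_det_col _ ord0) big_ord_recl big1; last first.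
  by move=> i _; rewrite !mxE /= !addr0 mul0r.
rewrite !mxE /cofactor /bump /= !addr0 !add0r expr1 expr0 mul1r mulN1r mulrN mulrA.
rewrite -expr2; congr (- (_ * \det _)).
by apply/matrixP => i j; rewrite !mxE /= /bump !add1n !eqSS.
Qed.

Lemma det_tridiag_addl n d b a :
  \det (tridiag_mx n.+1 (fun i => d i + a *+ (i == 0%N)) b) =
  \det (tridiag_mx n.+1 d b) + a * \det (tridiag_mx n (d \o S) (b \o S)).
Proof.
have shiftE m e :
    tridiag_mx m ((fun i => d i + a *+ (i == 0%N)) \o S \o e) (b \o S \o e) =
    tridiag_mx m (d \o S \o e) (b \o S \o e).
  by apply: eq_tridiag_mx => // i _ /=; rewrite addr0.
case: n => [|n]; first by rewrite !det_tridiag1 det_mx00 mulr1.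
by rewrite !det_tridiagSS (shiftE _ S) (shiftE _ id) /=; ring.
Qed.

End Tridiagonal.

Lemma char_poly_tridiag (A : comNzRingType) n (d b : nat -> A) :
  char_poly (tridiag_mx n d b) =
  \det (tridiag_mx n (fun i => 'X - (d i)%:P) (fun i => - (b i)%:P)).
Proof.
congr (\det _); apply/matrixP => i j; rewrite !mxE !polyCD !polyCMn.
by rewrite mulrnBl !mulNrn !opprD !addrA.
Qed.

(** * Lucas sequences *)

Section Lucas.
Variable A : comNzRingType.
Implicit Types P Q c : A.

Fixpoint lucasU P Q n : A :=
  match n with
  | 0 => 0
  | 1 => 1
  | (n'.+1 as n1).+1 => P * lucasU P Q n1 - Q * lucasU P Q n'
  end.

Lemma lucasUSS P Q n : lucasU P Q n.+2 = P * lucasU P Q n.+1 - Q * lucasU P Q n.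
Proof. by []. Qed.

(* The determinant of a path on [n] vertices, weights [P] and edges [c], whose last
   vertex has weight [P + c]; without this correction it is [lucasU P (c ^+ 2) n.+1]. *)
Definition lucas_mixed P c n : A := lucasU P (c ^+ 2) n.+1 + c * lucasU P (c ^+ 2) n.

Lemma lucas_mixedSS P c n :
  lucas_mixed P c n.+2 = P * lucas_mixed P c n.+1 - c ^+ 2 * lucas_mixed P c n.
Proof. by rewrite /lucas_mixed !lucasUSS; ring. Qed.

Lemma lucas_mixed_add P c n :
  lucas_mixed P c n.+1 + c * lucas_mixed P c n = (P + 2 * c) * lucasU P (c ^+ 2) n.+1.
Proof. by rewrite /lucas_mixed lucasUSS; ring. Qed.

End Lucas.
Arguments lucasU {A} P Q n : simpl never.

Lemma rmorph_lucasU (A B : comNzRingType) (f : {rmorphism A -> B}) P Q n :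
  f (lucasU P Q n) = lucasU (f P) (f Q) n.
Proof.
elim/ltn_ind: n => -[|[|n]] IH; rewrite ?rmorph0 ?rmorph1 //.
by rewrite !lucasUSS rmorphB !rmorphM !IH.
Qed.

(** * Determinants of cut paths *)

Section PathWords.
Variables (A : comNzRingType) (y c : A).
Implicit Types (v : A * A) (s : seq bool).

(* [v] holds the determinants of a path matrix with and without its first vertex;
   [path_cons cut v] puts a vertex in front of it, joined to it unless [cut]. *)
Definition path_cons (cut : bool) v : A * A :=
  (y * v.1 - (if cut then 0 else c ^+ 2) * v.2, v.1).

Definition path_close v : A := v.1 + c * v.2.

Definition path_det s : A := path_close (foldr path_cons (y + c, 1) s).

Lemma foldr_path_cons s :
  let d i := y + c *+ (i == size s) in
  let b i := if nth false s i then 0 else c in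
  foldr path_cons (y + c, 1) s =
  (\det (tridiag_mx (size s).+1 d b), \det (tridiag_mx (size s) (d \o S) (b \o S))).
Proof.
elim: s => [|cut s IH] /=; first by rewrite det_tridiag1 det_mx00.
rewrite IH [in RHS]det_tridiagSS /path_cons /= addr0.
by congr (_ * _ - _ * _, _); case: cut; rewrite ?expr0n.
Qed.

Lemma det_cut_path s :
  \det (tridiag_mx (size s).+1
    (fun i => y + c *+ (i == size s) + c *+ (i == 0%N))
    (fun i => if nth false s i then 0 else c)) = path_det s.
Proof.
rewrite (det_tridiag_addl _ (fun i => y + c *+ (i == size s))).
by rewrite /path_det foldr_path_cons.
Qed.

Definition word_prod m v : A :=
  \prod_(s : m.-tuple bool) path_close (foldr path_cons v s).

Lemma word_prod0 v : word_prod 0 v = path_close v.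
Proof. exact: (big_tuple0 _ (fun s => path_close (foldr path_cons v s))). Qed.

Lemma word_prodS m v :
  word_prod m.+1 v = word_prod m (path_cons false v) * word_prod m (path_cons true v).
Proof.
rewrite /word_prod (big_tuple_rcons _ _ (fun s => path_close (foldr path_cons v s))).
rewrite big_bool mulrC.
by congr (_ * _); apply: eq_bigr => s _; rewrite foldr_rcons.
Qed.

Lemma word_prodZ m a p q :
  word_prod m (a * p, a * q) = a ^+ (2 ^ m) * word_prod m (p, q).
Proof.
elim: m p q => [|m IH] p q; first by rewrite !word_prod0 /path_close /=; ring.
rewrite !word_prodS /path_cons /= !mul0r !subr0 !(mulrCA _ a) -mulrBr !IH.
by rewrite expnS mul2n -addnn exprD; ring.
Qed.

(* A cut leaves a multiple of [(y, 1)], the state of a single vertex. *)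
Definition restart_prod m : A := \prod_(0 <= i < m) word_prod i (y, 1).

Lemma word_prod_recurrence (u : nat -> A) m n :
  (forall i, u i.+2 = y * u i.+1 - c ^+ 2 * u i) ->
  word_prod m (u n.+1, u n) =
  (u (n + m).+1 + c * u (n + m)%N) *
  \prod_(1 <= i < m.+1) u (n + i)%N ^+ (2 ^ (m - i)) * restart_prod m.
Proof.
move=> u_rec; elim: m n => [|m IH] n.
  by rewrite word_prod0 /restart_prod !big_geq // !mulr1 addn0.
rewrite word_prodS /path_cons /= -u_rec mul0r subr0.
have -> : (y * u n.+1, u n.+1) = (u n.+1 * y, u n.+1 * 1) by rewrite mulr1 mulrC.
rewrite word_prodZ IH /restart_prod.
rewrite [\prod_(0 <= i < m.+1) _]big_nat_recr // [\prod_(1 <= i < m.+2) _]big_nat_recl //.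
under [in RHS]eq_big_nat do rewrite -addSnnS subSS.
by rewrite addn1 subSS subn0 -addSnnS /=; ring.
Qed.

Local Notation U := (lucasU y (c ^+ 2)).
Local Notation M := (lucas_mixed y c).

Lemma word_prod_restart m :
  word_prod m (y, 1) =
  M m.+1 * \prod_(1 <= i < m.+1) U i.+1 ^+ (2 ^ (m - i)) * restart_prod m.
Proof.
have -> : (y, 1) = (U 2, U 1) by congr pair; rewrite lucasUSS mulr1 mulr0 subr0.
by rewrite (word_prod_recurrence m 1 (lucasUSS y (c ^+ 2))) add1n.
Qed.

Lemma restart_prodE m :
  restart_prod m =
  \prod_(1 <= i < m.+1) M i ^+ (2 ^ (m - i)) *
  \prod_(1 <= i < m.+1) U i.+1 ^+ ((m - i) * 2 ^ (m - i - 1)).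
Proof.
elim: m => [|m IH]; first by rewrite /restart_prod !big_geq ?mulr1.
have -> : restart_prod m.+1 = restart_prod m ^+ 2 *
    (M m.+1 * \prod_(1 <= i < m.+1) U i.+1 ^+ (2 ^ (m - i))).
  rewrite {1}/restart_prod big_nat_recr //= -/(restart_prod m) word_prod_restart.
  by ring.
rewrite !(@big_nat_recr _ _ _ m.+1) //= subnn mul0n expr0 mulr1 expn0 expr1.
rewrite IH exprMn -!prodrXl -!mulrA [X in _ * X]mulrCA -big_split /=.
congr (_ * (_ * _)); apply: eq_big_nat => i; rewrite ltnS => /andP[_ le_im].
  by rewrite -exprM -expnSr subSn.
rewrite -exprM -exprD; congr (_ ^+ _); rewrite (subSn le_im) subSS subn0.
by case: (m - i)%N => [|d] //; rewrite subn1 /= !expnS; lia.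
Qed.

Lemma prod_path_det m :
  \prod_(s : m.-tuple bool) path_det s =
  (y + 2 * c) * U m.+1 *
  (\prod_(1 <= i < m.+1) M i ^+ (2 ^ (m - i + 1)) *
   \prod_(1 <= i < m.+1) U i.+1 ^+ ((m - i) * 2 ^ (m - i - 1))).
Proof.
have M_start : (y + c, 1) = (M 1, M 0).
  by rewrite /lucas_mixed lucasUSS; congr pair; rewrite /lucasU; ring.
rewrite -/(word_prod m (y + c, 1)) M_start.
rewrite (word_prod_recurrence _ _ (lucas_mixedSS y c)) add0n lucas_mixed_add.
rewrite restart_prodE -!mulrA [X in _ * (_ * X)]mulrA -big_split /=.
congr (_ * (_ * (_ * _))); apply: eq_bigr => i _.
by rewrite addn1 -exprD addnn -mul2n expnS.
Qed.

End PathWords.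

(** * Roots *)

Lemma monic_prod_XsubC (F : fieldType) (p : {poly F}) (rs : seq F) :
  p \is monic -> size p = (size rs).+1 -> all (root p) rs -> uniq rs ->
  p = \prod_(z <- rs) ('X - z%:P).
Proof.
move=> /monicP p_monic size_p rs_roots; rewrite -uniq_rootsE.
by move/(all_roots_prod_XsubC size_p rs_roots); rewrite p_monic scale1r.
Qed.

Section MonicLucas.
Variable A : comNzRingType.
Implicit Types (p q : {poly A}) (a b : A).

Lemma monic_size_addl p q n : p \is monic /\ size p = n.+1 -> (size q <= n)%N ->
  p + q \is monic /\ size (p + q) = n.+1.
Proof.
move=> [p_monic size_p] le_qn; have lt_qp : (size q < size p)%N by rewrite size_p.
by rewrite monicE lead_coefDl // -monicE size_polyDl.
Qed.

Lemma lucasU_monic_size a b n :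
  let p := lucasU ('X - a%:P) b%:P n.+1 in p \is monic /\ size p = n.+1.
Proof.
elim/ltn_ind: n => -[|[|n]] IH /=.
- by rewrite monic1 size_poly1.
- by rewrite lucasUSS mulr1 mulr0 subr0 monicXsubC size_XsubC.
have [monic1 size1] := IH n.+1 (ltnSn _); have [_ size0] := IH n (ltnW (ltnSn _)).
rewrite lucasUSS -mulNr -[- b%:P]polyCN mul_polyC; apply: monic_size_addl.
  by rewrite monicMr ?size_monicM ?monicXsubC ?monic_neq0 // size_XsubC size1.
by rewrite (leq_trans (size_scale_leq _ _)) // size0.
Qed.

Lemma lucas_mixed_monic_size a b n :
  let p := lucas_mixed ('X - a%:P) b%:P n in p \is monic /\ size p = n.+1.
Proof.
rewrite /lucas_mixed -rmorphXn /=; apply: monic_size_addl; first exact: lucasU_monic_size.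
rewrite mul_polyC (leq_trans (size_scale_leq _ _)) //.
case: n => [|n]; first by rewrite size_poly0.
by have [_ ->] := lucasU_monic_size a (b ^+ 2) n.
Qed.

End MonicLucas.

Section CosineRoots.
Variable R : realType.
Implicit Types (a c t : R) (p : {poly R}).

Lemma sin_mulrn_pi n : sin (pi *+ n) = 0 :> R.
Proof. by rewrite -[pi *+ n]add0r (alternatingn (@sinDpi R)) sin0 mulr0. Qed.

Lemma pi_frac_itv m n : (0 < m < n)%N -> 0 < (pi : R) * m%:R / n%:R < pi.
Proof.
move=> /andP[m_gt0 lt_mn]; have n_gt0 := ltn_trans m_gt0 lt_mn.
rewrite divr_gt0 ?mulr_gt0 ?pi_gt0 ?ltr0n //=.
by rewrite ltr_pdivrMr ?ltr0n // ltr_pM2l ?pi_gt0 // ltr_nat.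
Qed.

Lemma pi_frac_mulrn m n : (0 < n)%N -> (pi * m%:R / n%:R) *+ n = pi *+ m :> R.
Proof. by move=> n_gt0; rewrite -mulr_natr divfK ?pnatr_eq0 -?lt0n // mulr_natr. Qed.

Lemma lucasU_sin c t n :
  c * sin t * lucasU (2 * c * cos t) (c ^+ 2) n = c ^+ n * sin (t *+ n).
Proof.
elim/ltn_ind: n => -[|[|n]] IH; first by rewrite sin0 !mulr0.
  by rewrite mulr1.
rewrite lucasUSS mulrBr mulrCA IH // [X in _ - X]mulrCA IH //.
have -> : t *+ n = t *+ n.+1 - t by rewrite mulrSr addrK.
by rewrite [t *+ n.+2]mulrSr sinB sinD !exprS; ring.
Qed.

Lemma lucasU_cos_eq0 c m n : c != 0 -> (0 < m < n)%N ->
  lucasU (2 * c * cos (pi * m%:R / n%:R)) (c ^+ 2) n = 0.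
Proof.
move=> c_neq0 lt_mn; have n_gt0 : (0 < n)%N by lia.
set t := _ / _; have sin_t : sin t != 0 by rewrite gt_eqF // sin_gt0_pi // pi_frac_itv.
apply: (mulfI (mulf_neq0 c_neq0 sin_t)).
by rewrite lucasU_sin pi_frac_mulrn // sin_mulrn_pi !mulr0.
Qed.

(* [sin (t *+ n)] and [sin (t *+ n.+1)] agree because [t *+ n + t *+ n.+1] is an
   odd multiple of [pi]. *)
Lemma lucas_mixed_cos_eq0 c j n : c != 0 -> (j < n)%N ->
  lucas_mixed (- (2 * c * cos (pi * j.*2.+1%:R / n.*2.+1%:R))) c n = 0.
Proof.
move=> c_neq0 lt_jn; set t := _ / _.
have sin_t : sin t != 0 by rewrite gt_eqF // sin_gt0_pi // pi_frac_itv; lia.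
have c'_neq0 : - c != 0 by rewrite oppr_eq0.
apply: (mulfI (mulf_neq0 c'_neq0 sin_t)); rewrite mulr0 /lucas_mixed.
rewrite -mulNr -mulrN -sqrrN mulrDr lucasU_sin mulrCA lucasU_sin.
have -> : t *+ n.+1 = - (t *+ n) + pi *+ j.*2.+1.
  by rewrite -(@pi_frac_mulrn _ n.*2.+1) // -/t -addnn -addnS mulrnDr addKr.
rewrite (alternatingn (@sinDpi R)) sinN -[_ ^+ j.*2.+1]signr_odd /= odd_double exprS.
by ring.
Qed.

Lemma monic_prod_cos p a b n (s : seq nat) :
    p \is monic -> size p = (size s).+1 -> uniq s -> b != 0 ->
    {in s, forall j, (0 < j < n)%N /\ root p (a - b * cos (pi * j%:R / n%:R))} ->
  p = \prod_(j <- s) ('X - (a - b * cos (pi * j%:R / n%:R))%:P).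
Proof.
move=> p_monic size_p s_uniq b_neq0 s_roots.
rewrite -(big_map (fun j => a - b * cos (pi * j%:R / n%:R)) xpredT (fun x => 'X - x%:P)).
apply: monic_prod_XsubC => //; first by rewrite size_map.
  by apply/allP => _ /mapP[j /s_roots[_ root_j] ->].
rewrite map_inj_in_uniq // => i j /s_roots[lt_in _] /s_roots[lt_jn _].
move=> /addrI /oppr_inj /(mulfI b_neq0) /cos_inj.
have pi_frac_itvcc m : (0 < m < n)%N -> (pi : R) * m%:R / n%:R \in `[0, pi]%R.
  by move=> /pi_frac_itv /andP[gt0 lt_pi]; rewrite in_itv /= !ltW.
have n_neq0 : n%:R^-1 != 0 :> R.
  by rewrite invr_eq0 pnatr_eq0; lia.
move=> /(_ (pi_frac_itvcc _ lt_in) (pi_frac_itvcc _ lt_jn)) /(mulIf n_neq0).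
by move=> /(mulfI (lt0r_neq0 (pi_gt0 R))) /eqP; rewrite eqr_nat => /eqP.
Qed.

Lemma lucasU_prod_cos a c n : c != 0 ->
  lucasU ('X - a%:P) (c%:P ^+ 2) n.+1 =
  \prod_(1 <= j < n.+1) ('X - (a - 2 * c * cos (pi * j%:R / n.+1%:R))%:P).
Proof.
move=> c_neq0; rewrite -rmorphXn.
have [U_monic U_size] := lucasU_monic_size a (c ^+ 2) n.
apply: monic_prod_cos; rewrite ?size_iota ?iota_uniq ?subn1 ?mulf_neq0 ?pnatr_eq0 //.
move=> j; rewrite mem_index_iota => lt_jn; split=> //.
rewrite rootE -[_.[_]]/(horner_eval _ _) rmorph_lucasU /= /horner_eval !hornerE.
by rewrite [a - _ - a]addrAC subrr add0r -mulNr -mulrN -sqrrN lucasU_cos_eq0 ?oppr_eq0.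
Qed.

Lemma lucas_mixed_prod_cos a c n : c != 0 ->
  lucas_mixed ('X - a%:P) c%:P n =
  \prod_(0 <= j < n)
    ('X - (a - 2 * c * cos (pi * j.*2.+1%:R / n.*2.+1%:R))%:P).
Proof.
move=> c_neq0; have [M_monic M_size] := lucas_mixed_monic_size a c n.
have double_inj : injective (fun j => j.*2.+1) by move=> i j; lia.
rewrite -(big_map (fun j => j.*2.+1) xpredT
  (fun m => 'X - (a - 2 * c * cos (pi * m%:R / n.*2.+1%:R))%:P)).
apply: monic_prod_cos; rewrite ?size_map ?size_iota ?subn0 ?map_inj_uniq ?iota_uniq //.
  by rewrite mulf_neq0 ?pnatr_eq0.
move=> _ /mapP[j + ->]; rewrite mem_index_iota /= => lt_jn.
split; first by lia.
rewrite rootE /lucas_mixed -rmorphXn hornerD hornerCM.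
rewrite -![(lucasU _ _ _).[_]]/(horner_eval _ _) !rmorph_lucasU /= /horner_eval !hornerE.
by rewrite [a - _ - a]addrAC subrr add0r -/(lucas_mixed _ c n) lucas_mixed_cos_eq0.
Qed.

End CosineRoots.

(** * The Walsh transform of the butterfly graph *)

Section Walsh.
Variables (A : comNzRingType) (k : nat).
Local Notation word := {ffun 'I_k -> bool}.
Implicit Types (w s : word) (c : 'I_k.+1).

Definition walsh w s : A := \prod_i (-1) ^+ (w i && s i).

Lemma walsh0 w : walsh w [ffun=> false] = 1.
Proof. by apply: big1 => i _; rewrite ffunE andbF. Qed.

Lemma walsh_orthogonal w s :
  \sum_w' walsh w w' * walsh w' s = 2 ^+ k *+ (w == s).
Proof.
pose f i b : A := (-1) ^+ (w i && b) * (-1) ^+ (b && s i).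
transitivity (\prod_i \sum_b f i b).
  by rewrite bigA_distr_bigA; apply: eq_bigr => w' _; rewrite -big_split.
have sum_f i : \sum_b f i b = 2 *+ (w i == s i).
  by rewrite big_bool /f /= andbF andbT; case: (w i) (s i) => [] []; rewrite /=; ring.
have [w_eq_s | w_neq_s] := eqVneq w s.
  under eq_bigr do rewrite sum_f w_eq_s eqxx.
  by rewrite prodr_const card_ord.
have [i w_neq_s_i] : exists i, w i != s i.
  apply/existsP; apply: contraR w_neq_s; rewrite negb_exists => /forallP w_eq_s.
  by apply/eqP/ffunP => i; apply/eqP/negPn.
by rewrite (bigD1 i) //= sum_f (negPf w_neq_s_i) mul0r.
Qed.

Lemma flipbitK i : involutive (@flipbit k ^~ i).
Proof.
by move=> w; apply/ffunP => j; rewrite !ffunE; case: eqP => // ->; rewrite negbK.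
Qed.

Lemma flipbit_neq w i : flipbit w i != w.
Proof. by apply/eqP => /ffunP/(_ i); rewrite ffunE eqxx; case: (w i). Qed.

Lemma walsh_flipbit w s i : walsh (flipbit w i) s = (-1) ^+ s i * walsh w s.
Proof.
rewrite /walsh (bigD1 i) //= [in RHS](bigD1 i) //= mulrA ffunE eqxx; congr (_ * _).
  by case: (w i) (s i) => [] []; rewrite /=; ring.
by apply: eq_bigr => j /negPf ji; rewrite ffunE ji.
Qed.

Lemma bfwd_flipbit w w' (i : 'I_k) c c' :
  c = i :> nat ->
  bfwd (c, w) (c', w') = (c' == c.+1 :> nat) && ((w' == w) || (w' == flipbit w i)).
Proof.
move=> c_i; rewrite /bfwd /=; congr (_ && _).
apply/existsP/idP => [[j /andP[/eqP j_c]]|w'P]; last by exists i; rewrite c_i eqxx.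
by have -> : j = i by apply: val_inj; rewrite /= j_c c_i.
Qed.

Lemma bfwd_swap c c' w w' : bfwd (c, w') (c', w) = bfwd (c, w) (c', w').
Proof.
rewrite /bfwd /=; congr (_ && _); apply: eq_existsb => i; congr (_ && (_ || _)).
  exact: eq_sym.
by rewrite -(inv_eq (flipbitK i)) eq_sym.
Qed.

Definition edge_weight s (i : nat) : A :=
  if nth false [tuple s j | j < k] i then 0 else 2.

Lemma sum_bfwd_walsh c c' w s :
  \sum_w' (bfwd (c, w) (c', w'))%:R * walsh w' s =
  edge_weight s c *+ (c' == c.+1 :> nat) * walsh w s.
Proof.
have [cc' | /negPf c_neq_c'] := eqVneq (c' : nat) c.+1; last first.
  by rewrite mul0r big1 // => w' _; rewrite /bfwd /= c_neq_c' mul0r.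
have lt_ck : (c < k)%N by rewrite -ltnS -cc'.
pose i := Ordinal lt_ck.
under eq_bigr do rewrite (@bfwd_flipbit _ _ i) // cc' eqxx andTb.
rewrite (bigD1 w) //= eqxx (bigD1 (flipbit w i)) ?flipbit_neq //= eqxx orbT.
rewrite big1 => [|w' /andP[/negPf -> /negPf ->]]; last by rewrite mul0r.
rewrite walsh_flipbit /edge_weight -[c : nat]/(i : nat) nth_mktuple.
by case: (s i); rewrite /=; ring.
Qed.

Lemma badj_natr (u v : bvert k) : (badj u v)%:R = (bfwd u v)%:R + (bfwd v u)%:R :> A.
Proof.
rewrite /badj; have [uv | _] := boolP (bfwd u v); last by rewrite add0r.
suff /negPf -> : ~~ bfwd v u by rewrite addr0.
by move: uv => /andP[/eqP uv _]; rewrite /bfwd uv ltn_eqF.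
Qed.

Lemma sum_badj_walsh c c' w s :
  \sum_w' (badj (c, w) (c', w'))%:R * walsh w' s =
  tridiag_mx k.+1 (fun=> 0) (edge_weight s) c c' * walsh w s.
Proof.
under eq_bigr do rewrite badj_natr mulrDl [bfwd (c', _) _]bfwd_swap.
by rewrite big_split /= !sum_bfwd_walsh mxE mul0rn add0r mulrDl.
Qed.

Definition column_degree (i : nat) : A := 2 *+ (i < k)%N + 2 *+ (0 < i)%N.

(* The degrees are the row sums of the adjacency matrix, that is, its action on the
   Walsh function of the zero word. *)
Lemma bdegE (u : bvert k) : (bdeg u)%:R = column_degree u.1.
Proof.
case: u => c w; rewrite /bdeg -sum1dep_card natr_sum big_mkcond /=.
rewrite -(pair_bigA _ (fun c' w' => if badj (c, w) (c', w') then 1 else 0)) /=.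
have edge_weight0 i : edge_weight [ffun=> false] i = 2.
  rewrite /edge_weight; have [lt_ik | le_ki] := ltnP i k.
    by rewrite (nth_mktuple _ _ (Ordinal lt_ik)) ffunE.
  by rewrite nth_default // size_tuple.
transitivity (\sum_c' tridiag_mx k.+1 (fun=> 0) (edge_weight [ffun=> false]) c c').
  apply: eq_bigr => c' _; have := sum_badj_walsh c c' w [ffun=> false].
  rewrite walsh0 mulr1 => <-.
  by apply: eq_bigr => w' _; rewrite walsh0 mulr1; case: (badj _ _).
by rewrite row_sum_tridiag !edge_weight0 add0r.
Qed.

Definition butterfly_path s : 'M[A]_k.+1 :=
  tridiag_mx k.+1 column_degree (fun i => - edge_weight s i).

Definition laplacian_entry (u v : bvert k) : A := (bdeg u)%:R *+ (u == v) - (badj u v)%:R.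

Definition walsh_mx : 'M[A]_#|{: bvert k}| :=
  fin_mx (fun u v => walsh u.2 v.2 *+ (u.1 == v.1)).

Lemma mul_fin_mx_walsh (f : bvert k -> bvert k -> A) :
  fin_mx f *m walsh_mx = fin_mx (fun u v => \sum_w f u (v.1, w) * walsh w v.2).
Proof.
rewrite mul_fin_mx; apply: eq_fin_mx => u v; under eq_bigr do rewrite mulrnAr.
by rewrite sumr_mulrb (big_pair_fst _ v.1 (fun z => f u z * walsh z.2 v.2)).
Qed.

Lemma mul_walsh_fin_mx (f : bvert k -> bvert k -> A) :
  walsh_mx *m fin_mx f = fin_mx (fun u v => \sum_w walsh u.2 w * f (u.1, w) v).
Proof.
rewrite mul_fin_mx; apply: eq_fin_mx => u v; under eq_bigr do rewrite mulrnAl eq_sym.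
by rewrite sumr_mulrb (big_pair_fst _ u.1 (fun z => walsh u.2 z.2 * f z v)).
Qed.

Lemma sqr_walsh_mx : walsh_mx *m walsh_mx = (2 ^+ k)%:M.
Proof.
rewrite mul_walsh_fin_mx -fin_mx_scalar; apply: eq_fin_mx => [[c w] [c' s]] /=.
under eq_bigr do rewrite mulrnAr.
by rewrite sumrMnl walsh_orthogonal xpair_eqE andbC -mulnb mulrnA.
Qed.

Lemma laplacian_walsh :
  fin_mx laplacian_entry *m walsh_mx = walsh_mx *m fin_block_mx butterfly_path.
Proof.
rewrite mul_fin_mx_walsh mul_walsh_fin_mx; apply: eq_fin_mx => [[c w] [c' s]] /=.
under [RHS]eq_bigr do rewrite mulrnAr.
under eq_bigr do
  rewrite mulrBl xpair_eqE (eq_sym w) -mulnb mulrnA [_ *+ (_ == w) * _]mulrnAl.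
rewrite [RHS]sumr_mulrb big_pred1_eq sumrB sumr_mulrb big_pred1_eq.
rewrite sum_badj_walsh bdegE !mxE mul0rn add0r.
by rewrite [RHS]mulrC -mulrBl !mulNrn opprD addrA.
Qed.

Lemma char_poly_butterfly_path s :
  char_poly (butterfly_path s) = path_det ('X - 4%:P) 2%:P [tuple s i | i < k].
Proof.
rewrite char_poly_tridiag -det_cut_path size_tuple; congr (\det _).
apply: eq_tridiag_mx => i => [|]; last first.
  by rewrite /edge_weight; case: ifP; rewrite ?polyCN opprK.
rewrite inE ltnS /column_degree leq_eqVlt => /orP[/eqP -> | lt_ik].
  by rewrite ltnn eqxx lt0n; case: eqP => _; rewrite polyCD !polyCMn /=; ring.
by rewrite lt_ik ltn_eqF // lt0n; case: eqP => _; rewrite polyCD !polyCMn /=; ring.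
Qed.

End Walsh.

Lemma char_poly_blaplacian (R : realType) k :
  char_poly (blaplacian R k) = \prod_(s : k.-tuple bool) path_det ('X - 4%:P) 2%:P s.
Proof.
have -> : blaplacian R k = fin_mx (@laplacian_entry R k).
  by apply/matrixP => i j; rewrite !mxE /laplacian_entry [_ *+ (_ == _)]mulrb.
rewrite -(big_ffun_tuple _ (fun s => path_det _ _ (tval s))).
under [RHS]eq_bigr do rewrite -char_poly_butterfly_path.
rewrite -char_poly_fin_block_mx; apply: char_poly_intertwine (laplacian_walsh R k).
rewrite -sqrf_eq0 expr2 -det_mulmx sqr_walsh_mx det_scalar.
by rewrite !expf_neq0 // pnatr_eq0.
Qed.

Lemma prod_bspec (R : realType) k : (0 < k)%N ->
  let U := lucasU ('X - 4%:P) (2%:P ^+ 2) in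
  let M := lucas_mixed ('X - 4%:P) 2%:P in
  \prod_(x <- bspec R k) ('X - x%:P) =
  'X * U k.+1 *
  (\prod_(1 <= i < k.+1) M i ^+ (2 ^ (k - i + 1)) *
   \prod_(1 <= i < k.+1) U i.+1 ^+ ((k - i) * 2 ^ (k - i - 1))).
Proof.
move=> k_gt0 U M; have two_neq0 : 2 != 0 :> R by rewrite pnatr_eq0.
have two_mul_two : 2 * 2 = 4 :> R by rewrite -natrM.
rewrite /bspec !big_cat big_map !prodr_flatten_nseq /=; congr (_ * (_ * _)).
- rewrite big_cons mulr0 mul0r cos0 mulr1 subrr subr0 /U lucasU_prod_cos // two_mul_two.
  by rewrite /index_iota subn1.
- rewrite /index_iota subn1; apply: eq_bigr => i _; congr (_ ^+ _).
  rewrite /M lucas_mixed_prod_cos // two_mul_two /index_iota subn0.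
  by apply: eq_bigr => j _; rewrite !addn1 !mul2n.
rewrite [RHS]big_nat_recr //= subnn expr0 mulr1.
rewrite -/(index_iota 1 k); apply: eq_bigr => i _; congr (_ ^+ _).
rewrite /U lucasU_prod_cos // two_mul_two /index_iota subn1.
by apply: eq_bigr => j _; rewrite [_ * pi]mulrC.
Qed.

Theorem theoremA1 (R : realType) (k : nat) (hk : (1 <= k)%N) :
  char_poly (blaplacian R k) = \prod_(x <- bspec R k) ('X - x%:P).
Proof.
have two_mul_two : 2 * 2%:P = 4%:P :> {poly R} by rewrite !polyC_natr -natrM.
by rewrite char_poly_blaplacian prod_path_det prod_bspec // two_mul_two subrK.
Qed.
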